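(* Let $X$ be a finite quasigroup rack. Then for every $n$ the torsion subgroup of the rack homology group $H_n^R(X)$ is annihilated by $|X|$.
   Context: A rack is a set $X$ with a binary operation $*$ such that for each $b\in X$ the map $X\to X$, $x\mapsto x*b$, is a bijection, and $(a*b)*c=(a*c)*(b*c)$ for all $a,b,c\in X$. A rack is a quasigroup rack if for all $a,b\in X$ the equation $a*x=b$ has a unique solution $x\in X$. Rack homology: $C_n^R(X)$ is the free abelian group on the set $X^n$ of $n$-tuples, and the boundary map $\partial_n:C_n^R(X)\to C_{n-1}^R(X)$ is $$\partial_n(x_1,\ldots,x_n)=\sum_{i=1}^n(-1)^i\big[(x_1,\ldots,x_{i-1},x_{i+1},\ldots,x_n)-(x_1*x_i,\ldots,x_{i-1}*x_i,x_{i+1},\ldots,x_n)\big].$$ $H_n^R(X)$ is the $n$th homology group of $(C_*^R(X),\partial_* )$ (integer coefficients). *)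

(* Defs.v *)
From HB Require Import structures.
From mathcomp Require Import all_boot all_algebra.
From mathcomp Require Import generic_quotient ring_quotient.
From mathcomp.classical Require Import boolp.
From mathcomp Require Import freeg.

Set Implicit Arguments.
Unset Strict Implicit.
Unset Printing Implicit Defensive.

Import GRing.Theory.
Local Open Scope ring_scope.

Definition is_rack (X : Type) (op : X -> X -> X) : Prop :=
  (forall b, bijective (fun x => op x b)) /\
  (forall a b c, op (op a b) c = op (op a c) (op b c)).

Definition is_quasigroup_rack (X : Type) (op : X -> X -> X) : Prop :=
  is_rack op /\ (forall a b, exists! x, op a x = b).

Section SubquotientHomology.
Variables (A B C : zmodType) (f : {additive A -> B}) (g : {additive B -> C}).

Definition kerp : {pred B} := fun x => g x == 0.

Fact kerp_zmod_closed : zmod_closed kerp.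
Proof.
split=> [|x y]; rewrite !unfold_in ?raddf0 // => /eqP gx /eqP gy.
by rewrite raddfB gx gy subr0.
Qed.
HB.instance Definition _ := GRing.isZmodClosed.Build B kerp kerp_zmod_closed.

Record cycle_group := Cycle { cycle_val :> B; _ : cycle_val \in kerp }.
HB.instance Definition _ := [isSub for cycle_val].
HB.instance Definition _ := [Choice of cycle_group by <:].
HB.instance Definition _ := [SubChoice_isSubZmodule of cycle_group by <:].

(* The part of the image of f lying in the kernel of g; when g \o f = 0 this
   is the whole image of f. *)
Definition imp : {pred cycle_group} := fun z => `[< exists x, f x = val z >].

Fact imp_zmod_closed : zmod_closed imp.
Proof.
split=> [|x y]; rewrite !unfold_in.
  by apply/asboolP; exists 0; rewrite !raddf0.
move=> /asboolP[a fa] /asboolP[b fb]; apply/asboolP.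
by exists (a - b); rewrite !raddfB fa fb.
Qed.
HB.instance Definition _ :=
  GRing.isZmodClosed.Build cycle_group imp imp_zmod_closed.

(* ker g / im f *)
Definition homology : zmodType := Quotient.quot imp.

End SubquotientHomology.

Section RackHomology.
Variables (X : choiceType) (op : X -> X -> X).

Definition rack_chain (n : nat) : zmodType := {freeg (n.-tuple X) / int}.

(* Entries are numbered from 0, and fintype.lift i skips the value i, so that
   both faces delete the i-th entry of t; face1 i moreover acts by it on all
   the entries before it. (freeg has another lift.) *)
Definition face0 n (i : 'I_n) (t : n.-tuple X) : n.-1.-tuple X :=
  [tuple tnth t (fintype.lift i j) | j < n.-1].

Definition face1 n (i : 'I_n) (t : n.-tuple X) : n.-1.-tuple X :=
  [tuple if (j < i)%N then op (tnth t (fintype.lift i j)) (tnth t i)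
         else tnth t (fintype.lift i j) | j < n.-1].

(* The sign is (-1) ^+ i.+1 because entries are numbered from 0. *)
Definition boundary_tuple n (t : n.-tuple X) : {freeg (n.-1.-tuple X) / int} :=
  \sum_(i < n) (-1 : int) ^+ i.+1 *: (<< face0 i t >> - << face1 i t >>).

(* For n = 0 the sum above is empty, hence rack_boundary 0 is the zero map
   (with the dummy codomain rack_chain 0 standing for the zero group). *)
Definition rack_boundary n : rack_chain n -> rack_chain n.-1 :=
  fglift (@boundary_tuple n).

HB.instance Definition _ n :=
  GRing.isZmodMorphism.Build (rack_chain n) (rack_chain n.-1)
    (@rack_boundary n) (@lift_is_additive _ _ _ (@boundary_tuple n)).

Definition rack_homology (n : nat) : zmodType :=
  homology (@rack_boundary n.+1) (@rack_boundary n).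

End RackHomology.

Definition is_torsion (A : zmodType) (h : A) : Prop :=
  exists m : nat, (0 < m)%N /\ h *+ m = 0.

(* Main.v *)
From HB Require Import structures.
Require Import Defs.
From mathcomp Require Import all_boot all_algebra.
From mathcomp Require Import generic_quotient ring_quotient zify.
From mathcomp.classical Require Import boolp.
From mathcomp Require Import freeg.

Import GRing.Theory.
Local Open Scope ring_scope.

(* In a quasigroup rack y * y = y, because (y * y) * y = (y * y) * (y * y) and
   left translations are injective.  For j <= n and k in {j, j+1}, inserting a
   summed variable y after j copies of x_k,
     (x_1, ..., x_n) |-> sum_y (x_k, ..., x_k, y, x_{j+1}, ..., x_n),
   is a chain homotopy, up to sign, between |X| times the repeater
     (x_1, ..., x_n) |-> (x_k, ..., x_k, x_{j+1}, ..., x_n)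
   and the symmetrizer
     s_j : (x_1, ..., x_n) |-> sum_y (y, ..., y, x_{j+1}, ..., x_n).
   The repeaters for (j, j+1) and (j+1, j+1) coincide, so on homology
   |X| id = s_0 = s_1 = ... = s_n.  As s_n sends a chain to its degree times a
   fixed chain and boundaries have degree 0, s_n kills torsion. *)

(** * Idempotence and cancellation in quasigroup racks *)

Lemma quasigroup_rack_idem {X : Type} {op : X -> X -> X} :
  is_quasigroup_rack op -> forall y, op y y = y.
Proof.
move=> [[_ opD] opq] y.
have [x [_ xU]] := opq (op y y) (op (op y y) y).
by rewrite -(xU (op y y)) ?(xU y) // -opD.
Qed.

Lemma quasigroup_rack_injr {X : Type} {op : X -> X -> X} :
  is_quasigroup_rack op -> forall a, injective (op a).
Proof.
move=> [_ opq] a x y xy; have [z [_ zU]] := opq a (op a y).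
by rewrite -(zU x xy) -(zU y).
Qed.

Lemma quasigroup_rack_injl {X : Type} {op : X -> X -> X} :
  is_quasigroup_rack op -> forall b, injective (op^~ b).
Proof. by move=> [[opb _] _] b; apply: bij_inj. Qed.

Section FreegExtension.
Variables (K : choiceType) (M : zmodType).

(** Additivity is an explicit premise, so that composites given as plain functions can be compared
    on generators. *)
Lemma freeg_additive_ext (f g : {freeg K / int} -> M) :
    zmod_morphism f -> zmod_morphism g ->
  (forall t, f << t >> = g << t >>) -> forall z, f z = g z.
Proof.
move=> fB gB fg z.
pose f' : {additive _ -> _} := HB.pack f (GRing.isZmodMorphism.Build _ _ f fB).
pose g' : {additive _ -> _} := HB.pack g (GRing.isZmodMorphism.Build _ _ g gB).
rewrite -[f]/(f' : _ -> _) -[g]/(g' : _ -> _) -(freeg_sumE z) !raddf_sum.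
apply: eq_bigr => t _.
have -> : << coeff t z *g t >> = << t >> *~ coeff t z :> {freeg K / int}.
  by rewrite freegU_mulz intz.
by rewrite !raddfMz; congr (_ *~ _); exact: fg.
Qed.

End FreegExtension.

Section Homotopy.
Variables (X : finType) (op : X -> X -> X) (x0 : X).

(* Tuples are handled as sequences nat -> X, padded by x0.  The padding commutes
   with the faces, so indices past the end need no special treatment. *)
Definition seq_face0 (i : nat) (u : nat -> X) (k : nat) : X := u (bump i k).

Definition seq_face1 (i : nat) (u : nat -> X) (k : nat) : X :=
  if (k < i)%N then op (u k) (u i) else u (bump i k).

Definition cell (m : nat) (u : nat -> X) : rack_chain X m :=
  << [tuple u i | i < m] >>.

Lemma eq_cell m u v : (forall k, (k < m)%N -> u k = v k) -> cell m u = cell m v.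
Proof.
by move=> uv; congr (<< _ >>); apply: eq_from_tnth => i; rewrite !tnth_mktuple uv.
Qed.

Lemma cell_nth m (t : m.-tuple X) : cell m (nth x0 t) = << t >>.
Proof.
congr (<< _ >>); apply: eq_from_tnth => i.
by rewrite tnth_mktuple (tnth_nth x0).
Qed.

Lemma nth_face0 m (i : 'I_m) (t : m.-tuple X) :
  nth x0 (face0 i t) =1 seq_face0 i (nth x0 t).
Proof.
move=> k; rewrite /seq_face0; have [km|mk] := ltnP k m.-1.
  by rewrite (nth_mktuple _ _ (Ordinal km)) (tnth_nth x0).
have im := ltn_ord i.
by rewrite !nth_default ?size_tuple // /bump; lia.
Qed.

Lemma nth_face1 m (i : 'I_m) (t : m.-tuple X) :
  nth x0 (face1 op i t) =1 seq_face1 i (nth x0 t).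
Proof.
move=> k; rewrite /seq_face1; have [km|mk] := ltnP k m.-1.
  rewrite (nth_mktuple _ _ (Ordinal km)) !(tnth_nth x0) /= /bump.
  by case: ltnP => // ki; rewrite leqNgt ki.
have im := ltn_ord i.
(* Here [i <= m.-1 <= k]: past the end, face 1 acts on nothing and only padding is read. *)
rewrite ifF; last by lia.
by rewrite !nth_default ?size_tuple // /bump; lia.
Qed.

Lemma boundary_cell m u : rack_boundary op (cell m u) =
  \sum_(i < m) (-1 : int) ^+ i.+1 *:
    (cell m.-1 (seq_face0 i u) - cell m.-1 (seq_face1 i u)).
Proof.
rewrite /rack_boundary liftU scale1r; apply: eq_bigr => i _.
rewrite -(cell_nth _ (face0 _ _)) -(cell_nth _ (face1 _ _ _)).
have uE k : (k < m)%N -> nth x0 [tuple u i | i < m] k = u k.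
  by move=> km; rewrite (nth_mktuple _ _ (Ordinal km)).
have im := ltn_ord i.
congr (_ *: (_ - _)); apply: eq_cell => k km.
  by rewrite nth_face0 /seq_face0 uE // /bump; lia.
by rewrite nth_face1 /seq_face1 !uE // /bump; lia.
Qed.

(* The index k0 counts from 0, whereas j is a number of entries: k0 = j - 1 and
   k0 = j are x_j and x_{j+1} in the header. *)
Definition insert (j k0 : nat) (u : nat -> X) (y : X) (k : nat) : X :=
  if (k < j)%N then u k0 else if k == j then y else u k.-1.

Definition homotopy (j k0 m : nat) : rack_chain X m -> rack_chain X m.+1 :=
  fglift (fun t : m.-tuple X => \sum_y cell m.+1 (insert j k0 (nth x0 t) y)).

Definition constant_prefix (j : nat) (y : X) (u : nat -> X) (k : nat) : X :=
  if (k < j)%N then y else u k.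

Definition repeater (j k0 m : nat) : rack_chain X m -> rack_chain X m :=
  fglift (fun t : m.-tuple X => cell m (constant_prefix j (nth x0 t k0) (nth x0 t))).

Definition symmetrizer (j m : nat) : rack_chain X m -> rack_chain X m :=
  fglift (fun t : m.-tuple X => \sum_y cell m (constant_prefix j y (nth x0 t))).

Hypothesis hX : is_quasigroup_rack op.

(** * Faces of tuples with an inserted summed entry *)

Section Faces.
Variables (j k0 n : nat) (u : nat -> X).
Hypotheses (k0j : (k0 <= j)%N) (jk0 : (j <= k0.+1)%N).

(** The unsigned [i]-th terms of boundary after homotopy ([A]) and of homotopy after boundary
    ([B]). *)
Let A i := \sum_y (cell n.+1 (seq_face0 i (insert j k0 u y)) -
                   cell n.+1 (seq_face1 i (insert j k0 u y))).
Let B i := \sum_y (cell n.+1 (insert j k0 (seq_face0 i u) y) -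
                   cell n.+1 (insert j k0 (seq_face1 i u) y)).

(** The first [j] entries are copies of [u k0], on which [u k0] acts trivially by idempotence. *)
Lemma face_insert_lt i : (i < j)%N -> A i = 0.
Proof.
move=> ij; apply: big1 => y _; apply/eqP; rewrite subr_eq0; apply/eqP.
apply: eq_cell => k _; rewrite /seq_face0 /seq_face1; case: ltnP => // ki.
have -> : bump i k = k by rewrite /bump; lia.
by rewrite /insert ij (ltn_trans ki ij) (quasigroup_rack_idem hX).
Qed.

(** [insert] reads its sequence only at [k0 >= i] and from [j] on, where the two faces agree. *)
Lemma insert_face_lt i : (i < j)%N -> B i = 0.
Proof.
move=> ij; apply: big1 => y _; apply/eqP; rewrite subr_eq0; apply/eqP.
apply: eq_cell => k _; rewrite /insert /seq_face0 /seq_face1.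
case: ltnP => kj; first by rewrite ifF //; lia.
by case: eqP => // kNj; rewrite ifF //; lia.
Qed.

(** Face 0 removes [y] and leaves [#|X|] equal terms; in face 1, [op (u k0) y] runs through all of
    [X]. *)
Lemma face_insert_eq :
  A j = cell n.+1 (constant_prefix j (u k0) u) *+ #|X| -
        \sum_y cell n.+1 (constant_prefix j y u).
Proof.
rewrite /A sumrB; congr (_ - _).
  rewrite -sumr_const; apply: eq_bigr => y _; apply: eq_cell => k _.
  rewrite /seq_face0 /insert /constant_prefix /bump.
  case: (leqP j k) => kj; last by rewrite kj.
  by rewrite add1n ltnNge leqW //= gtn_eqF.
(* Face 1 at the inserted entry turns the first j entries into op (u k0) y. *)
rewrite [RHS](reindex_inj (quasigroup_rack_injr hX (u k0))) /=.
apply: eq_bigr => y _; apply: eq_cell => k _.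
rewrite /seq_face1 /insert /constant_prefix /bump ltnn eqxx.
case: ltnP => kj //.
by rewrite add1n ltnNge leqW //= gtn_eqF.
Qed.

(** Face 1 also acts by [u i] on the inserted [y]; summation over [y] absorbs this, since right
    translations permute [X]. *)
Lemma face_insert_gt i : (j <= i)%N -> A i.+1 = B i.
Proof.
move=> ji; rewrite /A /B !sumrB.
have ui y : insert j k0 u y i.+1 = u i.
  by rewrite /insert ltnNge leqW // gtn_eqF.
have [ik0|ik0] := leqP i k0.
  (* Here the deleted entry is u k0 itself: both sides vanish separately. *)
  have [ek ej] : k0 = i /\ j = i by lia.
  rewrite [X in X - _ = _](_ : _ = \sum_y cell n.+1 (seq_face1 i.+1 (insert j k0 u y))).
    rewrite subrr; apply/esym/eqP; rewrite subr_eq0; apply/eqP.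
    apply: eq_bigr => y _; apply: eq_cell => k _.
    rewrite /insert /seq_face0 /seq_face1 ek ej ltnn.
    by case: ltnP => // ki; case: eqP => // kNi; rewrite ifF //; lia.
  rewrite (reindex_inj (quasigroup_rack_injl hX (u i))).
  apply: eq_bigr => y _; apply: eq_cell => k _.
  rewrite /seq_face1 ui /seq_face0 /insert ek ej.
  case: (ltngtP k i) => ki.
  - have -> : bump i.+1 k = k by rewrite /bump; lia.
    by rewrite ki ltnS (ltnW ki) (quasigroup_rack_idem hX).
  - have -> : bump i.+1 k = k.+1 by rewrite /bump ki.
    by rewrite ltnS (leqNgt k) ki ltnNge leqW ?(ltnW ki) //= gtn_eqF // ltnS ltnW.
  - have -> : bump i.+1 k = k by rewrite /bump; lia.
    by rewrite ki ltnSn ltnn eqxx.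
congr (_ - _).
  apply: eq_bigr => y _; apply: eq_cell => k _.
  rewrite /insert /seq_face0.
  have -> : (bump i.+1 k < j)%N = (k < j)%N by rewrite /bump; lia.
  have -> : (bump i.+1 k == j) = (k == j) by rewrite /bump; lia.
  case: ltnP => kj; first by congr u; rewrite /bump; lia.
  by case: eqVneq => // kNj; congr u; rewrite /bump; lia.
rewrite [RHS](reindex_inj (quasigroup_rack_injl hX (u i))).
apply: eq_bigr => y _; apply: eq_cell => k _.
rewrite /seq_face1 ui /insert ik0.
have -> : (bump i.+1 k < j)%N = (k < j)%N by rewrite /bump; lia.
have -> : (bump i.+1 k == j) = (k == j) by rewrite /bump; lia.
case: (ltnP k j) => kj; first by rewrite ifT //; lia.
case: (eqVneq k j) => [->|kNj]; first by rewrite ltnS ji.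
have -> : (k.-1 < i)%N = (k < i.+1)%N by lia.
by case: ifP => // ki; congr u; rewrite /bump; lia.
Qed.

Hypothesis jn : (j <= n.+1)%N.

Lemma boundary_homotopy_sum :
  \sum_(i < n.+2) (-1 : int) ^+ i.+1 *: A i +
  \sum_(i < n.+1) (-1 : int) ^+ i.+1 *: B i =
  (-1 : int) ^+ j.+1 *: (cell n.+1 (constant_prefix j (u k0) u) *+ #|X| -
        \sum_y cell n.+1 (constant_prefix j y u)).
Proof.
(* Splitting off [j] turns the other indices into [lift j i]: for [j <= i] the equal terms [A i.+1]
   and [B i] carry opposite signs, otherwise [A i] and [B i] both vanish. *)
rewrite (bigD1_ord (Ordinal (jn : (j < n.+2)%N))) //= -face_insert_eq -addrA.
rewrite -big_split /= big1 ?addr0 // => i _.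
rewrite /bump; case: (leqP j i) => ji.
  by rewrite add1n face_insert_gt // -scalerDl exprSr mulrN1 addNr scale0r.
by rewrite add0n face_insert_lt // insert_face_lt // !scaler0 addr0.
Qed.

End Faces.

(** * The homotopy formula on chains *)

Lemma homotopy_is_zmod_morphism j k0 m : zmod_morphism (@homotopy j k0 m).
Proof. exact: lift_is_additive. Qed.

Lemma repeater_is_zmod_morphism j k0 m : zmod_morphism (@repeater j k0 m).
Proof. exact: lift_is_additive. Qed.

Lemma symmetrizer_is_zmod_morphism j m : zmod_morphism (@symmetrizer j m).
Proof. exact: lift_is_additive. Qed.

HB.instance Definition _ j k0 m :=
  GRing.isZmodMorphism.Build (rack_chain X m) (rack_chain X m.+1)
    (@homotopy j k0 m) (@homotopy_is_zmod_morphism j k0 m).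

Lemma homotopyU j k0 m (t : m.-tuple X) :
  homotopy j k0 m << t >> = \sum_y cell m.+1 (insert j k0 (nth x0 t) y).
Proof. by rewrite /homotopy liftU scale1r. Qed.

Lemma homotopyP j k0 n (z : rack_chain X n.+1) :
    (k0 <= j)%N -> (j <= k0.+1)%N -> (j <= n.+1)%N ->
  rack_boundary op (homotopy j k0 n.+1 z) + homotopy j k0 n (rack_boundary op z)
  = (-1 : int) ^+ j.+1 *: (repeater j k0 n.+1 z *+ #|X| - symmetrizer j n.+1 z).
Proof.
move=> k0j jk0 jn.
apply: (@freeg_additive_ext _ _
  (fun z => rack_boundary op (homotopy j k0 n.+1 z) +
            homotopy j k0 n (rack_boundary op z))
  (fun z => (-1 : int) ^+ j.+1 *:
     (repeater j k0 n.+1 z *+ #|X| - symmetrizer j n.+1 z))) => [a b|a b|t].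
- by rewrite !raddfB opprD addrACA.
- rewrite repeater_is_zmod_morphism symmetrizer_is_zmod_morphism -scalerBr.
  rewrite mulrnBl; congr (_ *: _).
  by rewrite !opprB addrACA [RHS]addrACA; congr (_ + _); rewrite addrC.
rewrite homotopyU /repeater /symmetrizer !liftU !scale1r.
rewrite -boundary_homotopy_sum //; congr (_ + _).
  rewrite raddf_sum (eq_bigr _ (fun y _ => boundary_cell _ _)).
  by rewrite exchange_big; apply: eq_bigr => i _; rewrite -scaler_sumr.
rewrite /rack_boundary liftU scale1r /boundary_tuple raddf_sum.
apply: eq_bigr => i _.
rewrite raddfZsign raddfB sumrB; congr (_ *: (_ - _)); rewrite [LHS]homotopyU.
  by apply: eq_bigr => y _; apply: eq_cell => k _; rewrite /insert !nth_face0.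
by apply: eq_bigr => y _; apply: eq_cell => k _; rewrite /insert !nth_face1.
Qed.

(** * Boundaries and degrees *)

Definition bounds {n} (z : rack_chain X n) : Prop :=
  exists w : rack_chain X n.+1, rack_boundary op w = z.

Lemma boundsB n (z1 z2 : rack_chain X n) :
  bounds z1 -> bounds z2 -> bounds (z1 - z2).
Proof. by move=> [w1 <-] [w2 <-]; exists (w1 - w2); rewrite raddfB. Qed.

Lemma repeater_symmetrizer j k0 n (z : rack_chain X n.+1) :
    (k0 <= j)%N -> (j <= k0.+1)%N -> (j <= n.+1)%N -> rack_boundary op z = 0 ->
  bounds (repeater j k0 n.+1 z *+ #|X| - symmetrizer j n.+1 z).
Proof.
move=> k0j jk0 jn z0; have := homotopyP j k0 n z k0j jk0 jn.
rewrite z0 raddf0 addr0 => bz.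
(* The sign squares to 1, so it can be moved into the witness. *)
exists ((-1 : int) ^+ j.+1 *: homotopy j k0 n.+1 z).
by rewrite raddfZsign [X in _ *: X]bz signrZK.
Qed.

(** Entry [j], counted from 0, already is the value being repeated, so overwriting it changes
    nothing. *)
Lemma eq_repeater j n (z : rack_chain X n) : repeater j j n z = repeater j.+1 j n z.
Proof.
apply: (freeg_additive_ext _ _ (repeater j j n) (repeater j.+1 j n)) => [||t];
  try exact: repeater_is_zmod_morphism.
rewrite /repeater !liftU; congr (_ *: _); apply: eq_cell => k _.
by rewrite /constant_prefix ltnS; case: ltngtP => // ->.
Qed.

Lemma symmetrizer0 n (z : rack_chain X n) : symmetrizer 0 n z = z *+ #|X|.
Proof.
apply: (freeg_additive_ext _ _ (symmetrizer 0 n) (fun z => z *+ #|X|))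
  => [|a b|t]; [exact: symmetrizer_is_zmod_morphism|exact: mulrnBl|].
rewrite /symmetrizer liftU scale1r -[RHS]sumr_const; apply: eq_bigr => y _.
exact: cell_nth.
Qed.

(** All entries are overwritten, so every generator has the same image. *)
Lemma symmetrizer_full n (z : rack_chain X n) :
  symmetrizer n n z = (\sum_y cell n (fun=> y)) *~ deg z.
Proof.
apply: (freeg_additive_ext _ _ (symmetrizer n n)
  (fun z => (\sum_y cell n (fun=> y)) *~ deg z)) => [|a b|t].
- exact: symmetrizer_is_zmod_morphism.
- by rewrite degB mulrzBr.
rewrite /symmetrizer liftU scale1r degU; apply: eq_bigr => y _.
by apply: eq_cell => k kn; rewrite /constant_prefix kn.
Qed.

Lemma deg_boundary n (w : rack_chain X n) : deg (rack_boundary op w) = 0.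
Proof.
apply: (freeg_additive_ext _ _ (fun w : rack_chain X n => deg (rack_boundary op w))
  (fun=> 0)) => [a b|a b|t]; first by rewrite raddfB degB.
  by rewrite subr0.
rewrite /rack_boundary liftU scale1r raddf_sum big1 // => i _.
by rewrite /= -signr_odd scaler_sign; case: odd; rewrite ?degN degB !degU subrr ?oppr0.
Qed.

Lemma cycle_bounds n (z : rack_chain X n) :
  rack_boundary op z = 0 -> deg z = 0 -> bounds (z *+ #|X|).
Proof.
move=> z0 dz; rewrite -symmetrizer0.
suff /(_ n (leqnn n)) : forall j, (j <= n)%N ->
    bounds (symmetrizer 0 n z - symmetrizer j n z).
  by rewrite symmetrizer_full dz mulr0z subr0.
elim=> [_|j IHj jn]; first by rewrite subrr; exists 0; rewrite raddf0.
(* [j < n] makes [n] a successor, as the homotopy formula requires. *)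
case: n z z0 {dz} IHj jn => // n z z0 IHj jn.
(* The symmetrizers for [j] and [j.+1] are both compared with the repeater of entry [j], which
   cancels by [eq_repeater]. *)
have -> : symmetrizer 0 n.+1 z - symmetrizer j.+1 n.+1 z =
    (symmetrizer 0 n.+1 z - symmetrizer j n.+1 z) -
    ((repeater j j n.+1 z *+ #|X| - symmetrizer j n.+1 z) -
     (repeater j.+1 j n.+1 z *+ #|X| - symmetrizer j.+1 n.+1 z)).
  rewrite eq_repeater opprB (opprB _ (symmetrizer j _ z)).
  by rewrite [_ - symmetrizer j.+1 _ _ + _]addrC !subrKA.
by apply: boundsB; [exact: IHj (ltnW jn)|apply: boundsB];
  apply: repeater_symmetrizer => //; exact: ltnW.
Qed.

End Homotopy.

Theorem corollary1p10 (X : finType) (op : X -> X -> X)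
    (hX : is_quasigroup_rack op) (n : nat) (h : rack_homology op n) :
  is_torsion h -> h *+ #|X| = 0.
Proof.
(* [x0] serves as padding; for empty [X] the factor [#|X|] is 0. *)
case: (pickP X) => [x0 _|/eq_card0 ->]; last by rewrite mulr0n.
have bP z : reflect (bounds X op (\val z))
    (\pi_(rack_homology op n)%qT z == 0 :> rack_homology op n).
  rewrite -[X in _ == X](raddf0 \pi_(rack_homology op n)%qT) -Quotient.idealrBE subr0.
  exact: asboolP.
elim/quotW: h => z [m [m0]].
rewrite -!raddfMn => /eqP/bP[w bw]; apply/eqP/bP.
rewrite raddfMn; apply: (cycle_bounds _ _ x0) => //; first exact/eqP/(valP z).
(* [m] times the degree of [z] is the degree of a boundary, hence 0, and [int] has no torsion. *)
have /eqP := deg_boundary X op n.+1 w.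
rewrite bw raddfMn degMn Num.Theory.mulrn_eq0 eqn0Ngt m0.
exact: eqP.
Qed.
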